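(* Let $X$ be a $\sigma_f$-$\beta$-unfavorable space, let $Y$ be a space, let $y_*\in Y$ be a nearly $q_D$-point with respect to some dense subset $D$ of $Y$, and let $\Phi: X\times Y\to\mathbb R$ be a separately continuous function. Then $\Phi$ is strongly quasi-continuous at the point $(x_*,y_* )$ for every $x_*\in X$.
   Context: All spaces are Tychonoff. All games are played by two players $\alpha$ and $\beta$ for countably many steps $n=0,1,2,\dots$; strategies may depend on all previous moves. A game is $\theta$-favorable if player $\theta$ has a winning strategy, and $\theta$-unfavorable otherwise. Two subsets $A,B$ of a space $X$ are functionally separated if there is a continuous $g:X\to[0,1]$ with $g(A)\subset\{0\}$ and $g(B)\subset\{1\}$. $\sigma_f$-$\beta$-unfavorable spaces: put $U_{-1}=X$. At step $n$, player $\beta$ chooses a nonempty open set $V_n\subset U_{n-1}$, and then player $\alpha$ chooses a nonempty open set $U_n\subset V_n$ and a point $x_n\in X$. Player $\alpha$ wins if the sets $\bigcap_n V_n$ and $\{x_n: n\in\omega\}$ are not functionally separated in $X$. The space $X$ is $\sigma_f$-$\beta$-unfavorable if this game is $\beta$-unfavorable. Nearly $q_D$-points: let $D$ be a dense subset of $Y$ and $y_*\in Y$. Put $W_{-1}=Y$. At step $n$, player $\beta$ chooses a point $y_n\in W_{n-1}\cap D$, and then player $\alpha$ chooses a neighborhood $W_n$ of $y_*$. Player $\alpha$ wins if the sequence $(y_n)_{n\in\omega}$ has an accumulation point in $Y$. The point $y_*$ is a nearly $q_D$-point (with respect to $D$) if this game is $\alpha$-favorable. A map $f:X\times Y\to Z$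 is strongly quasi-continuous at $(x_*,y_* )$ if for any neighborhood $W$ of $f(x_*,y_* )$ and any neighborhood $U\times V$ of $(x_*,y_* )$ there exist a nonempty open $U'\subset U$ and a neighborhood $V'\subset V$ of $y_*$ such that $f(U'\times V')\subset W$. *)

(* Defs.v *)
From HB Require Import structures.
From mathcomp Require Import all_boot all_order all_algebra.
From mathcomp Require Import all_classical all_reals all_analysis.

Set Implicit Arguments.
Unset Strict Implicit.
Unset Printing Implicit Defensive.

Import Order.TTheory GRing.Theory Num.Theory.
Import numFieldNormedType.Exports.
Local Open Scope classical_set_scope.
Local Open Scope ring_scope.

(* A history [h : seq (bmove * amove)] lists the completed rounds in
   chronological order.  Whoever makes an illegal move first loses; [awins] is
   only consulted on infinite plays in which all moves are legal. *)
Record game := Game {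
  bmove : Type;
  amove : Type;
  blegal : seq (bmove * amove) -> bmove -> Prop;
  alegal : seq (bmove * amove) -> bmove -> amove -> Prop;
  awins : (nat -> bmove * amove) -> Prop
}.

(* Histories in which beta follows [s] and all moves of alpha are legal. *)
Inductive beta_history (G : game)
    (s : seq (bmove G * amove G) -> bmove G) :
    seq (bmove G * amove G) -> Prop :=
| beta_history_nil : beta_history s [::]
| beta_history_rcons h a : beta_history s h -> alegal h (s h) a ->
    beta_history s (rcons h (s h, a)).

(* Histories in which alpha follows [t] and all moves of beta are legal. *)
Inductive alpha_history (G : game)
    (t : seq (bmove G * amove G) -> bmove G -> amove G) :
    seq (bmove G * amove G) -> Prop :=
| alpha_history_nil : alpha_history t [::]
| alpha_history_rcons h b : alpha_history t h -> blegal h b ->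
    alpha_history t (rcons h (b, t h b)).

Definition beta_winning (G : game)
    (s : seq (bmove G * amove G) -> bmove G) : Prop :=
  (forall h, beta_history s h -> blegal h (s h)) /\
  (forall p : nat -> bmove G * amove G,
     (forall n, beta_history s (mkseq p n)) -> ~ awins p).

Definition alpha_winning (G : game)
    (t : seq (bmove G * amove G) -> bmove G -> amove G) : Prop :=
  (forall h b, alpha_history t h -> blegal h b -> alegal h b (t h b)) /\
  (forall p : nat -> bmove G * amove G,
     (forall n, alpha_history t (mkseq p n)) -> awins p).

Definition beta_favorable (G : game) : Prop :=
  exists s : seq (bmove G * amove G) -> bmove G, beta_winning s.

Definition alpha_favorable (G : game) : Prop :=
  exists t : seq (bmove G * amove G) -> bmove G -> amove G, alpha_winning t.

(* [completely_regular_space] does not include any separation of points. *)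
Definition tychonoff_space (T : topologicalType) : Prop :=
  completely_regular_space T /\ hausdorff_space T.

Definition functionally_separated (R : realType) (X : topologicalType)
    (A B : set X) : Prop :=
  exists g : X -> R,
    [/\ continuous g, range g `<=` `[0, 1]%classic,
        g @` A `<=` [set 0] & g @` B `<=` [set 1]].

(* beta plays V_n, alpha answers with the pair (U_n, x_n); the value of [last]
   is U_(n-1), with U_(-1) = X. *)
Definition sigma_f_game (R : realType) (X : topologicalType) : game :=
  {| bmove := set X;
     amove := set X * X;
     blegal := fun h V =>
       [/\ open V, V !=set0 & V `<=` last setT [seq m.2.1 | m <- h]];
     alegal := fun _ V a => [/\ open a.1, a.1 !=set0 & a.1 `<=` V];
     awins := fun p =>
       ~ functionally_separated R (\bigcap_n (p n).1)
           (range (fun n => (p n).2.2)) |}.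

Definition sigma_f_beta_unfavorable (R : realType) (X : topologicalType)
    : Prop :=
  ~ beta_favorable (sigma_f_game R X).

(* beta plays y_n, alpha answers with W_n; the value of [last] is W_(n-1), with
   W_(-1) = Y. *)
Definition q_game (Y : topologicalType) (D : set Y) (ystar : Y) : game :=
  {| bmove := Y;
     amove := set Y;
     blegal := fun h y => (last setT [seq m.2 | m <- h] `&` D) y;
     alegal := fun _ _ W => nbhs ystar W;
     awins := fun p => cluster ((fun n => (p n).1) @ \oo) !=set0 |}.

Definition nearly_q_point (Y : topologicalType) (D : set Y) (ystar : Y)
    : Prop :=
  alpha_favorable (q_game D ystar).

Definition separately_continuous (X Y Z : topologicalType)
    (f : X * Y -> Z) : Prop :=
  (forall x : X, continuous (fun y : Y => f (x, y))) /\
  (forall y : Y, continuous (fun x : X => f (x, y))).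

Definition strongly_quasi_continuous_at (X Y Z : topologicalType)
    (f : X * Y -> Z) (xstar : X) (ystar : Y) : Prop :=
  forall (W : set Z) (U : set X) (V : set Y),
    nbhs (f (xstar, ystar)) W -> nbhs xstar U -> nbhs ystar V ->
    exists (U' : set X) (V' : set Y),
      [/\ open U', U' !=set0 & U' `<=` U] /\
      [/\ nbhs ystar V', V' `<=` V & f @` (U' `*` V') `<=` W].

(* Main.v *)
(* Were Phi not strongly quasi-continuous at (xstar, ystar), beta could win the
   sigma_f game.  With V_n she chooses a point y_n of D such that Phi(_, y_n)
   stays away from c = Phi(xstar, ystar) on V_n, while Phi(x_i, y_n) is close to
   Phi(x_i, ystar) for i < n; the y_n are played against a winning strategy of
   alpha in the q-game, hence they have an accumulation point yoo.  The
   continuous function |Phi(_, yoo) - Phi(_, ystar)| is then large on the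
   intersection of the V_n and small at every x_i, so it separates them. *)
Require Import Defs.
From HB Require Import structures.
From mathcomp Require Import all_boot all_order all_algebra.
From mathcomp Require Import all_classical all_reals all_analysis.
From mathcomp Require Import lra.

Set Implicit Arguments.
Unset Strict Implicit.
Unset Printing Implicit Defensive.

Import Order.TTheory GRing.Theory Num.Theory.
Import numFieldNormedType.Exports.
Local Open Scope classical_set_scope.
Local Open Scope ring_scope.

(** Rescale affinely so that [b] goes to 0 and [a] to 1, then truncate to [0, 1]. *)
Lemma functionally_separated_le_ge (R : realType) (X : topologicalType)
    (A B : set X) (g : X -> R) (a b : R) :
  continuous g -> a < b -> (forall x, A x -> b <= g x) ->
  (forall x, B x -> g x <= a) -> functionally_separated R A B.
Proof.
move=> cg ab Ab Ba.
have ba0 : 0 < b - a by rewrite subr_gt0.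
exists (fun x => Num.max 0 (Num.min 1 ((b - g x) / (b - a)))); split.
- move=> x.
  apply: (@continuous_max R X (cst 0)); first exact: cvg_cst.
  apply: (@continuous_min R X (cst 1)); first exact: cvg_cst.
  by apply: cvgMr_tmp; apply: cvgB; [exact: cvg_cst|exact: cg].
- move=> _ [x _ <-] /=; rewrite in_itv /= le_max lexx /=.
  by rewrite ge_max ler01 ge_min lexx.
- move=> _ [x /Ab bg <-] /=; apply/max_idPl.
  rewrite ge_min; apply/orP; right.
  by rewrite pmulr_lle0 ?invr_gt0// subr_le0.
- move=> _ [x /Ba ga <-] /=.
  have -> : Num.min 1 ((b - g x) / (b - a)) = 1.
    by apply/min_idPl; rewrite ler_pdivlMr// mul1r lerB.
  by apply/max_idPr.
Qed.

Lemma cluster_closed (T : topologicalType) (F : set_system T) (C : set T)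
    (y : T) : cluster F y -> closed C -> F C -> C y.
Proof. by rewrite clusterE => Fy Ccl FC; apply: Ccl; exact: Fy. Qed.

(** Ensures that the set from which beta draws her next point of the q-game is still a neighborhood,
    so that it can be fed to [ext] below. *)
Lemma nbhs_last_alpha_history (Y : topologicalType) (D : set Y) (y : Y)
    (t : seq (Y * set Y) -> Y -> set Y) (k : seq (Y * set Y)) :
  alpha_winning (G := q_game D y) t -> alpha_history (G := q_game D y) t k ->
  nbhs y (last setT [seq m.2 | m <- k]).
Proof.
move=> [tlegal _]; case=> [|h b th bl] /=; first exact: filterT.
by rewrite map_rcons last_rcons; exact: (tlegal h b th bl).
Qed.

(* The data beta carries along a play of the sigma_f game: the history of the
   auxiliary q-game, the last open set played by alpha, and the set of the y
   satisfying the conditions imposed by alpha's points x_0, ..., x_(n-1). *)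
Record shadow (X Y : Type) := Shadow {
  shadow_history : seq (Y * set Y);
  shadow_open : set X;
  shadow_test : set Y
}.

(** The first component is the move V_n of the sigma_f game, the second the point y_n of the
    q-game. *)
Definition shadow_choice (X Y : Type) (next : set X -> set Y -> set X * Y)
    (st : shadow X Y) : set X * Y :=
  next (shadow_open st)
    (last setT [seq m.2 | m <- shadow_history st] `&` shadow_test st).

(** A sigma_f history does not record y_n; recomputing it from the state makes the state a function
    of the history, as a strategy requires. *)
Definition shadow_step (X Y : Type) (next : set X -> set Y -> set X * Y)
    (t : seq (Y * set Y) -> Y -> set Y) (test : X -> set Y)
    (st : shadow X Y) (m : set X * (set X * X)) : shadow X Y :=
  let k := shadow_history st in
  let y := (shadow_choice next st).2 in
  Shadow (rcons k (y, t k y)) m.2.1 (shadow_test st `&` test m.2.2).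

Definition shadow_of (X Y : Type) (next : set X -> set Y -> set X * Y)
    (t : seq (Y * set Y) -> Y -> set Y) (test : X -> set Y) (U : set X)
    (h : seq (set X * (set X * X))) : shadow X Y :=
  foldl (shadow_step next t test) (Shadow [::] U setT) h.

Lemma shadow_of_rcons (X Y : Type) (next : set X -> set Y -> set X * Y)
    (t : seq (Y * set Y) -> Y -> set Y) (test : X -> set Y) (U : set X) h m :
  shadow_of next t test U (rcons h m) =
  shadow_step next t test (shadow_of next t test U h) m.
Proof. by rewrite /shadow_of foldl_rcons. Qed.

(** Beta plays both games at once: [ext], applied to alpha's last open set and to his last q-move
    cut down by the tests so far, yields V_n and y_n together. This strategy cannot be winning, and
    a play that beats it carries a q-game play following [t], whence the cluster point. *)
Lemma sigma_f_unfavorable_play (R : realType) (X Y : topologicalType)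
    (D : set Y) (ystar : Y) (U : set X) (P : set (X * Y)) (test : X -> set Y) :
  sigma_f_beta_unfavorable R X -> nearly_q_point D ystar ->
  open U -> U !=set0 ->
  (forall x, nbhs ystar (test x)) ->
  (forall U' V', open U' -> U' !=set0 -> U' `<=` U -> nbhs ystar V' ->
     exists V y, [/\ open V, V !=set0, V `<=` U', (V' `&` D) y &
                     V `*` [set y] `<=` P]) ->
  exists (p : nat -> set X * (set X * X)) (y : nat -> Y),
    [/\ ~ functionally_separated R (\bigcap_n (p n).1)
            (range (fun n => (p n).2.2)),
        cluster (y @ \oo) !=set0,
        forall n, (p n).1 `*` [set y n] `<=` P &
        forall i n, (i < n)%N -> test (p i).2.2 (y n)].
Proof.
move=> unfav [t twin] oU U0 ntest ext.
have [next nextP] : exists next : set X -> set Y -> set X * Y,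
    forall U' V', open U' -> U' !=set0 -> U' `<=` U -> nbhs ystar V' ->
    [/\ open (next U' V').1, (next U' V').1 !=set0, (next U' V').1 `<=` U',
        (V' `&` D) (next U' V').2 &
        (next U' V').1 `*` [set (next U' V').2] `<=` P].
  have [x0 _] := U0.
  have /choice[f fP] : forall UV : set X * set Y, exists Vy : set X * Y,
      open UV.1 -> UV.1 !=set0 -> UV.1 `<=` U -> nbhs ystar UV.2 ->
      [/\ open Vy.1, Vy.1 !=set0, Vy.1 `<=` UV.1, (UV.2 `&` D) Vy.2 &
          Vy.1 `*` [set Vy.2] `<=` P].
    move=> [U' V'] /=.
    have [[oU' U'0 U'U nV']|nH] := pselect
        [/\ open U', U' !=set0, U' `<=` U & nbhs ystar V'].
      have [V [y Vy]] := ext _ _ oU' U'0 U'U nV'.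
      by exists (V, y).
    (* A default value, for arguments violating the hypotheses of [ext]. *)
    by exists (set0, ystar) => *; exfalso; apply: nH.
  by exists (fun U' V' => f (U', V')) => U' V'; exact: (fP (U', V')).
pose st := shadow_of next t test U.
pose s h := (shadow_choice next (st h)).1.
pose G := sigma_f_game R X.
have inv h : beta_history (G := G) s h ->
    [/\ alpha_history (G := q_game D ystar) t (shadow_history (st h)),
        [/\ open (shadow_open (st h)), shadow_open (st h) !=set0,
            shadow_open (st h) `<=` U &
            shadow_open (st h) `<=` last setT [seq m.2.1 | m <- h]],
        nbhs ystar (shadow_test (st h)) &
        [/\ open (s h), s h !=set0, s h `<=` shadow_open (st h),
         (last setT [seq m.2 | m <- shadow_history (st h)] `&`
          shadow_test (st h) `&` D) (shadow_choice next (st h)).2 &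
         s h `*` [set (shadow_choice next (st h)).2] `<=` P]].
  (* The last clause of [inv] follows from the others at the same history; at the previous history
     it gives the legality of the new q-move. *)
  have step h' :
      alpha_history (G := q_game D ystar) t (shadow_history (st h')) ->
      [/\ open (shadow_open (st h')), shadow_open (st h') !=set0,
          shadow_open (st h') `<=` U &
          shadow_open (st h') `<=` last setT [seq m.2.1 | m <- h']] ->
      nbhs ystar (shadow_test (st h')) ->
      [/\ open (s h'), s h' !=set0, s h' `<=` shadow_open (st h'),
       (last setT [seq m.2 | m <- shadow_history (st h')] `&`
        shadow_test (st h') `&` D) (shadow_choice next (st h')).2 &
       s h' `*` [set (shadow_choice next (st h')).2] `<=` P].
    move=> ht [? ? ? _] nt; apply: nextP => //; apply: filterI => //.
    exact: nbhs_last_alpha_history ht.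
  elim=> [|{}h [U' x] bh [ht [oh h0 hU _] nt [os s0 sh [[yW yt] yD] _]]].
    have H1 : alpha_history (G := q_game D ystar) t (shadow_history (st [::])).
      exact: alpha_history_nil.
    have H2 : [/\ open (shadow_open (st [::])), shadow_open (st [::]) !=set0,
         shadow_open (st [::]) `<=` U & shadow_open (st [::]) `<=` setT] by split.
    by split=> //; [exact: filterT | apply: step => //; exact: filterT].
  move=> [/= oU' U'0 U's].
  have E : st (rcons h (s h, (U', x))) =
      shadow_step next t test (st h) (s h, (U', x)) by exact: shadow_of_rcons.
  have H1 : alpha_history (G := q_game D ystar) t
      (shadow_history (st (rcons h (s h, (U', x))))).
    by rewrite E /=; apply: (alpha_history_rcons (G := q_game D ystar)).
  have H2 : [/\ open (shadow_open (st (rcons h (s h, (U', x))))),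
       shadow_open (st (rcons h (s h, (U', x)))) !=set0,
       shadow_open (st (rcons h (s h, (U', x)))) `<=` U &
       shadow_open (st (rcons h (s h, (U', x)))) `<=`
         last setT [seq m.2.1 | m <- rcons h (s h, (U', x))]].
    rewrite E /= map_rcons last_rcons; split=> //.
    by move=> z /U's/sh/hU.
  have H3 : nbhs ystar (shadow_test (st (rcons h (s h, (U', x))))).
    by rewrite E; apply: filterI.
  by split=> //; exact: step.
have [p [pb pwin]] : exists p : nat -> set X * (set X * X),
    (forall n, beta_history (G := G) s (mkseq p n)) /\ awins (g := G) p.
  (* By [inv] all moves of [s] are legal, so if alpha won no play against it, [s] would be
     winning. *)
  apply: contrapT => nop; apply: unfav; exists s; split.
    by move=> h /inv[_ [_ _ _ hl] _ [? ? sh _ _]]; split=> // z /sh/hl.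
  by move=> p pb pwin; apply: nop; exists p.
pose S n := st (mkseq p n).
pose y n := (shadow_choice next (S n)).2.
have SS n : S n.+1 = shadow_step next t test (S n) (p n).
  by rewrite /S mkseqS; exact: shadow_of_rcons.
have ps n : (p n).1 = s (mkseq p n).
  have := pb n.+1; rewrite mkseqS => bh.
  inversion bh as [E|h a _ _ E]; first by move: E; case: (mkseq p n).
  by move/rcons_inj : E => [<- <-].
exists p, y; split => //.
(* The shadow histories are the initial segments of a single infinite play following [t]. *)
- have /(_ (fun n => (y n, t (shadow_history (S n)) (y n)))) := twin.2.
  apply => n.
  have -> : mkseq (fun n => (y n, t (shadow_history (S n)) (y n))) n =
      shadow_history (S n).
    by elim: n => [//|n IH]; rewrite SS mkseqS IH.
  by have [] := inv _ (pb n).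
- by move=> n; rewrite ps; have [_ _ _ []] := inv _ (pb n).
- move=> i n ltin.
  have [_ _ _ [_ _ _ [[_ yt] _] _]] := inv _ (pb n).
  (* Test sets only shrink, and the test of x_i enters at stage i + 1. *)
  suff : shadow_test (S n) `<=` test (p i).2.2 by apply.
  elim: n ltin {yt} => [//|n IH]; rewrite ltnS leq_eqVlt SS /=.
  by case/predU1P => [->|/IH {}IH] z [zn zt] //; exact: IH.
Qed.

Theorem theorem3 (R : realType) (X Y : topologicalType)
    (tychonoffX : tychonoff_space X) (tychonoffY : tychonoff_space Y)
    (unfavX : sigma_f_beta_unfavorable R X)
    (D : set Y) (denseD : dense D)
    (ystar : Y) (qystar : nearly_q_point D ystar)
    (Phi : X * Y -> R) (sepPhi : separately_continuous Phi) :
  forall xstar : X, strongly_quasi_continuous_at Phi xstar ystar.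
Proof.
move=> xstar W U V /nbhs_ballP[r /= r0 rW] nU nV.
have [contY contX] := sepPhi.
set c := Phi (xstar, ystar) in rW.
apply: contrapT => nex.
have cdist (T : topologicalType) (f : T -> R) (a : R) :
    continuous f -> continuous (fun z => `|f z - a|).
  move=> cf z; apply: cvg_norm; apply: cvgB; [exact: cf|exact: cvg_cst].
have ogt (T : topologicalType) (f : T -> R) a b :
    continuous f -> open [set z | b < `|f z - a|].
  move=> cf; apply: (@open_comp _ _ (fun z => `|f z - a|) [set s | b < s]).
    by move=> z _; exact: cdist.
  exact: open_gt.
have olt (T : topologicalType) (f : T -> R) a b :
    continuous f -> open [set z | `|f z - a| < b].
  move=> cf; apply: (@open_comp _ _ (fun z => `|f z - a|) [set s | s < b]).
    by move=> z _; exact: cdist.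
  exact: open_lt.
have cge (T : topologicalType) (f : T -> R) a b :
    continuous f -> closed [set z | b <= `|f z - a|].
  move=> cf; apply: (@closed_comp _ _ (fun z => `|f z - a|) [set s | b <= s]).
    by move=> z _; exact: cdist.
  exact: closed_ge.
have cle (T : topologicalType) (f : T -> R) a b :
    continuous f -> closed [set z | `|f z - a| <= b].
  move=> cf; apply: (@closed_comp _ _ (fun z => `|f z - a|) [set s | s <= b]).
    by move=> z _; exact: cdist.
  exact: closed_le.
(* Staying 3/4 r away from c at yoo and within r / 4 of c at [ystar] forces a difference of at least
   r / 2, against at most r / 4 at the points x_i. *)
pose U0 := U^° `&` [set x | `|Phi (x, ystar) - c| < r / 4].
have oU0 : open U0.
  by apply: openI; [exact: open_interior|exact: olt (contX ystar)].
have U0x : U0 xstar.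
  by split => //=; rewrite subrr normr0; lra.
have [|||p [y [nsep [yoo clyoo] Py testy]]] := @sigma_f_unfavorable_play R X Y
    D ystar U0 [set z | U0 z.1 /\ 3 / 4 * r < `|Phi z - c|]
    (fun x => [set y | `|Phi (x, y) - Phi (x, ystar)| < r / 4]) unfavX qystar
    oU0.
- by exists xstar.
- move=> x; apply: (open_nbhs_nbhs (conj (olt _ _ _ _ (contY x)) _)).
  by rewrite /= subrr normr0; lra.
- move=> U' V' oU' U'0 U'U0 nV'.
  (* The failure of quasi-continuity gives a point at distance at least r from c. Relaxing r to 3/4
     r makes the condition open: continuity in y and density move y into [D], then continuity in x
     thickens x to an open set. *)
  have [x [y [U'x yV rxy]]] : exists x y,
      [/\ U' x, (V' `&` V)^° y & r <= `|Phi (x, y) - c|].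
    apply: contrapT => nxy; apply: nex; exists U', ((V' `&` V)^°); split.
      by split=> // z /U'U0[/interior_subset].
    have nVV : nbhs ystar (V' `&` V) by exact: filterI.
    split; [exact: nbhs_interior|by move=> z /interior_subset[]|].
    move=> _ [[x y] [/= U'x yV] <-]; apply: rW.
    rewrite /ball /= distrC ltNge; apply/negP => rle.
    by apply: nxy; exists x, y.
  have oN : open ((V' `&` V)^° `&` [set y | 3 / 4 * r < `|Phi (x, y) - c|]).
    by apply: openI; [exact: open_interior|exact: ogt (contY x)].
  have [|y' [[yV' ry'] Dy']] := denseD _ _ oN.
    by exists y; split=> //=; lra.
  exists (U' `&` [set x | 3 / 4 * r < `|Phi (x, y') - c|]), y'; split.
  + by apply: openI => //; exact: ogt (contX y').
  + by exists x.
  + by move=> z [].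
  + by split=> //; have [] := interior_subset yV'.
  + by move=> [a b] /= [[U'a ra] ->]; split=> //; exact: U'U0.
apply: nsep.
have cg : continuous (fun x => `|Phi (x, yoo) - Phi (x, ystar)|).
  by move=> x; apply: cvg_norm; apply: cvgB; exact: contX.
apply: (functionally_separated_le_ge (a := r / 4) (b := r / 2) cg).
- by lra.
- move=> x px.
  have Ux : `|Phi (x, ystar) - c| < r / 4.
    by have [[]] := Py 0%N (x, y 0%N) (conj (px 0%N I) erefl).
  (* For fixed x in every V_n, the bound at all y_n passes to the cluster point once weakened to a
     closed condition. *)
  have : [set z | 3 / 4 * r <= `|Phi (x, z) - c|] yoo.
    apply: (cluster_closed clyoo).
      exact: cge (contY x).
    exists 0%N => // n _ /=; apply: ltW.
    by have [_] := Py n (x, y n) (conj (px n I) erefl).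
  move=> /= rx.
  have := ler_distD (Phi (x, ystar)) (Phi (x, yoo)) c.
  lra.
- move=> _ [i _ <-].
  apply: (cluster_closed (C := [set z | `|Phi ((p i).2.2, z) -
      Phi ((p i).2.2, ystar)| <= r / 4]) clyoo).
    exact: cle (contY _).
  (* The test of x_i binds y_n only for n > i, which is enough for a cluster point. *)
  by exists i.+1 => // n /= ltin; apply: ltW; exact: testy.
Qed.
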